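(* Let $n$ be a power of a prime number and let $\mathbb{F}_n$ denote the field with $n$ elements. Set $I_0=\Omega_0=\mathbb{F}_n$ and $G_0=\{g_{\ell m}:\ell,m\in\mathbb{F}_n\}$, where $g_{\ell m}:I_0\to\Omega_0$, $g_{\ell m}(i)=\ell i+m$ (operations in $\mathbb{F}_n$). Then $G_0$ consists of $n^2$ elements, and the probability measure $\mathbb{P}_0$ on $G_0$ given by $\mathbb{P}_0(\{g\})=\frac1{n^2}$ for all $g\in G_0$ satisfies (i) $\mathbb{P}_0(g(i)=j)=\frac1n$ for all $(i,j)\in I_0\times\Omega_0$, (ii) $\mathbb{P}_0(g(i_1)=j_1,\ g(i_2)=j_2)\le\frac1{n^2}$ for all $(i_1,j_1)\ne(i_2,j_2)$ in $I_0\times\Omega_0$. *)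

(* Defs.v *)
From HB Require Import structures.
From mathcomp Require Import all_boot all_order all_algebra.
From mathcomp Require Import all_classical all_reals all_analysis.

Set Implicit Arguments.
Unset Strict Implicit.
Unset Printing Implicit Defensive.

Import GRing.Theory.
Local Open Scope ring_scope.

Definition affine_fun (F : finFieldType) (l m : F) : {ffun F -> F} :=
  [ffun i => l * i + m].

(* The set of maps: distinct parameter pairs are not assumed to give distinct
   elements. *)
Definition G0 (F : finFieldType) : {set {ffun F -> F}} :=
  [set affine_fun l m | l : F, m : F].

Lemma affine_fun_G0 (F : finFieldType) (l m : F) : affine_fun l m \in G0 F.
Proof. by apply/imset2P; exists l m. Qed.

(* [G0 F] as a type, with every subset measurable; the library's measurable
   types must be pointed, hence the arbitrary choice of the zero map. *)
Definition G0_type (F : finFieldType) : Type :=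
  {g : {ffun F -> F} | g \in G0 F}.

HB.instance Definition _ (F : finFieldType) := Finite.on (G0_type F).
HB.instance Definition _ (F : finFieldType) :=
  isPointed.Build (G0_type F) (exist _ (affine_fun 0 0) (affine_fun_G0 0 0)).
HB.instance Definition _ (F : finFieldType) :=
  @isMeasurable.Build default_measure_display (G0_type F)
    discrete_measurable discrete_measurable0
    discrete_measurableC discrete_measurableU.

(* Main.v *)
(* The parameters (l, m) are in bijection with the maps in G_0, so events can be
   counted in F_n^2: g(i) = j leaves l free and determines m, whereas two
   conditions either determine l (i_1 <> i_2) or contradict each other. *)
Require Import Defs.
From HB Require Import structures.
From mathcomp Require Import all_boot all_order all_algebra.
From mathcomp Require Import all_classical all_reals all_analysis.
From mathcomp Require Import ring.
Import Order.TTheory GRing.Theory Num.Theory.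
Local Open Scope classical_set_scope.
Local Open Scope ring_scope.

(** Evaluation recovers the parameters: the value at 0 is [m] and the value at 1 is [l + m]. *)
Lemma affine_fun_inj (F : finFieldType) :
  injective (fun p : F * F => affine_fun p.1 p.2).
Proof.
move=> [l m] [l' m'] /ffunP E.
have := E 0; rewrite !ffunE /= !mulr0 !add0r => mm'.
have := E 1; rewrite !ffunE /= !mulr1 mm' => /addIr ll'.
by rewrite ll'.
Qed.

Definition affine_G0 {F : finFieldType} (p : F * F) : G0_type F :=
  exist _ (affine_fun p.1 p.2) (affine_fun_G0 p.1 p.2).

Lemma affine_G0_bij (F : finFieldType) : bijective (@affine_G0 F).
Proof.
have surj (g : G0_type F) : exists p : F * F, affine_G0 p == g.
  case: g => g Gg; have /imset2P[l m _ _ gE] := Gg.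
  by exists (l, m); apply/eqP/val_inj.
have invK g : affine_G0 (xchoose (surj g)) = g by exact/eqP/(xchooseP (surj g)).
(* [invK] is one cancellation law. The other follows from it by injectivity, since [p] and the pair
   chosen for its map define the same map. *)
exists (fun g => xchoose (surj g)) => // p.
by apply: (@affine_fun_inj F); have /(congr1 val) := invK (affine_G0 p).
Qed.

Lemma card_G0_type (F : finFieldType) : #|{: G0_type F}| = (#|F| ^ 2)%N.
Proof. by rewrite -(bij_eq_card (affine_G0_bij F)) card_prod. Qed.

Lemma card_G0 (F : finFieldType) : #|G0 F| = (#|F| ^ 2)%N.
Proof. by rewrite -card_G0_type card_sig. Qed.

Lemma card_G0_pred (F : finFieldType) (P : pred (G0_type F)) :
  #|P| = #|[pred p | P (affine_G0 p)]|.
Proof.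
rewrite -(on_card_preimset (R := P) (onW_bij _ (affine_G0_bij F))).
by apply: eq_card => p; rewrite !inE.
Qed.

Lemma card_G0_eval {F : finFieldType} (i j : F) :
  #|[pred g : G0_type F | val g i == j]| = #|F|.
Proof.
rewrite card_G0_pred.
(* The solutions [(l, m)] form the graph of [l |-> j - l * i], with one point for each [l]. *)
rewrite -(card_codom (f := fun l : F => (l, j - l * i))); last by move=> l l' [].
apply: eq_card => -[l m]; rewrite !inE /= ffunE.
apply/eqP/codomP => [<-|[k [-> ->]]]; last by rewrite addrC subrK.
by exists l; rewrite addrAC subrr add0r.
Qed.

Lemma card_G0_eval2 {F : finFieldType} {i1 j1 i2 j2 : F} :
  (i1, j1) <> (i2, j2) ->
  (#|[pred g : G0_type F | (val g i1 == j1) && (val g i2 == j2)]| <= 1)%N.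
Proof.
move=> ij; rewrite card_G0_pred; apply/card_le1_eqP => -[l m] [l' m'].
rewrite !inE /= !ffunE => /andP[/eqP e1 /eqP e2] /andP[/eqP e1' /eqP e2'].
(* Given a solution, [i1 = i2] would force [j1 = j2], contradicting [ij]. *)
have ii : i1 - i2 != 0.
  by rewrite subr_eq0; apply/eqP => ii; apply: ij; rewrite -e1 -e2 ii.
(* Subtracting the two conditions eliminates the constant term and leaves [l * (i1 - i2) = j1 - j2],
   and likewise for [l']. *)
have ll : l = l'.
  apply: (mulIf ii).
  have -> : l * (i1 - i2) = j1 - j2 by rewrite -e1 -e2; ring.
  by rewrite -e1' -e2'; ring.
by move: e1; rewrite -e1' ll => /addrI ->.
Qed.

(** Every set here is a finite disjoint union of singletons, so additivity determines the measure
    from its point masses. This turns probabilities into cardinalities and also yields the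
    uniqueness of [P0]. *)
Lemma measure_eq_card {F : finFieldType} {R : realType}
    {mu : {measure set (G0_type F) -> \bar R}} {c : R} :
  (forall g, mu [set g] = c%:E) ->
  forall A, mu A = (c *+ #|[pred g | g \in A]|)%:E.
Proof.
move=> muc A; rewrite -[in LHS](image_id A) -bigcup_imset1.
rewrite measure_fin_bigcup //; [|exact: finite_finset|by move=> x y _ _ [z [-> ->]]].
rewrite -[in LHS](set_mem_set A) -(bigfs _ (enum_uniq {: G0_type F})) //; last first.
  by move=> g _; rewrite mem_enum.
rewrite big_enum_cond (eq_bigr (fun=> c%:E)) => [|g _]; last exact: muc.
by rewrite sumEFin sumr_const.
Qed.

Theorem mainTheorem5 (R : realType) (n : nat)
    (n_prime_power : exists p k : nat, [/\ prime p, (0 < k)%N & n = (p ^ k)%N])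
    (F : finFieldType) (cardF : #|F| = n) :
  #|G0 F| = (n ^ 2)%N /\
  exists P0 : probability (G0_type F) R,
    [/\ forall g : G0_type F, P0 [set g] = (1 / n%:R ^+ 2)%:E,
        forall Q : probability (G0_type F) R,
          (forall g : G0_type F, Q [set g] = (1 / n%:R ^+ 2)%:E) ->
          forall A : set (G0_type F), Q A = P0 A,
        forall i j : F,
          P0 [set g : G0_type F | \val g i = j] = (1 / n%:R)%:E &
        forall i1 j1 i2 j2 : F, (i1, j1) <> (i2, j2) ->
          (P0 [set g : G0_type F | \val g i1 = j1 /\ \val g i2 = j2]
             <= (1 / n%:R ^+ 2)%:E)%E].
Proof.
split; first by rewrite card_G0 cardF.
have n0 : n%:R != 0 :> R.
  by rewrite pnatr_eq0 -lt0n -cardF; apply/card_gt0P; exists 0.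
pose mu : {measure set (G0_type F) -> \bar R} := counting.
have mu1 g : mu [set g] = 1%:E.
  by rewrite /mu /= /counting asboolT // fset_set1 finmap.cardfs1.
have muT : mu [set: G0_type F] = (n%:R ^+ 2)%:E.
  rewrite (measure_eq_card mu1) -natrX -cardF -card_G0_type.
  by rewrite (eq_card (B := {: G0_type F})) // => g; rewrite !inE mem_set.
(* [dirac point] is only the fallback of [mnormalize] for total mass zero or infinity; the mass is
   [n ^ 2], nonzero and finite, so it is never reached. *)
pose P0 : probability (G0_type F) R := mnormalize mu (dirac point).
have P01 g : P0 [set g] = (1 / n%:R ^+ 2)%:E.
  rewrite /P0 /= /mnormalize muT /= orbF eqe expf_eq0 (negbTE n0) /=.
  by rewrite mu1 div1r mul1e.
exists P0; split => //.
- by move=> Q Q1 A; rewrite (measure_eq_card Q1) (measure_eq_card P01).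
- move=> i j; rewrite (measure_eq_card P01).
  rewrite (_ : #|_| = n); last first.
    rewrite -cardF -(card_G0_eval i j); apply: eq_card => g.
    by rewrite !inE; apply/idP/eqP => [/set_mem|/mem_set].
  by rewrite -mulr_natr; congr _%:E; field.
- move=> i1 j1 i2 j2 ij; rewrite (measure_eq_card P01) lee_fin.
  (* With the bound read as one point mass, it remains to see that the event contains at most one
     map. *)
  rewrite -[leRHS]mulr1n; apply: ler_wpMn2l; first by rewrite divr_ge0 ?exprn_ge0.
  apply: leq_trans (card_G0_eval2 ij); apply/subset_leq_card/fintype.subsetP => g.
  by move=> Ag; have /= [e1 e2] := set_mem Ag; rewrite inE /= e1 e2 !eqxx.
Qed.
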